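(* Let $f(x)\in\mathbb{Z}[x]$ be a univariate polynomial of degree $d$ and $p$ a prime. Let $k>d(\Delta+1)$ and let $\mathbf{a}:=a_0+pa_1+p^2a_2+\cdots+p^{l-1}a_{l-1}+p^l*$ be a representative-root of $f(x)\bmod p^k$. Let $\bar{\alpha}_i:=\alpha_i\bmod p^k$ for all $i\in[n]$. Fix $i\in[n]$. Then: (1) The length of $\mathbf{a}$ satisfies $l>\Delta+1$. (2) If $\bar{\alpha}_i\in\mathbf{a}$, then $\bar{\alpha}_j\notin\mathbf{a}$ for all $j\ne i$, $j\in[n]$. (3) If $\mathbf{a}$ contains $\bar{\alpha}_i$ then it also contains the neighborhood $S_{k,i}$; in fact, if $\bar{\alpha}_i\in\mathbf{a}$, then $S_{k,i}=\mathbf{a}$.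
   Context: $\mathbb{Z}_p$ is the ring of $p$-adic integers, $v_p$ the $p$-adic valuation (with $v_p(0)=\infty$), and $[n]=\{1,\ldots,n\}$. The polynomial $f$ is viewed in $\mathbb{Z}_p[x]$, with factorization into coprime irreducible factors over $\mathbb{Z}_p$ (up to a unit of $\mathbb{Z}_p$) $f(x)=\prod_{i\in[n]}(x-\alpha_i)^{e_i}\cdot\prod_{j=1}^m g_j(x)^{t_j}$, where $\alpha_1,\dots,\alpha_n$ are the distinct $\mathbb{Z}_p$-roots of $f$, $e_i$ is the multiplicity of $\alpha_i$, and each $g_j\in\mathbb{Z}_p[x]$ is irreducible over $\mathbb{Z}_p$, has no $\mathbb{Z}_p$-root and has multiplicity $t_j$ in $f$. The radical is $\mathrm{rad}(f):=\prod_{i=1}^n(x-\alpha_i)\cdot\prod_{j=1}^m g_j(x)$. The discriminant of a polynomial $h$ of degree $m$ over a field, with leading coefficient $h_m$ and roots $r_1,\dots,r_m$ in an algebraic closure, is $D(h):=h_m^{2m-1}\prod_{1\le i<j\le m}(r_i-r_j)^2$, and the discriminant of a linear polynomial is defined to be $1$. $\Delta:=v_p(D(\mathrm{rad}(f)))$. For $a_0,\dots,a_{l-1}\in\{0,\dots,p-1\}$, the representative $a_0+pa_1+\cdots+p^{l-1}a_{l-1}+p^l*$ is the set of all elements of $\mathbb{Z}/\langle p^k\rangle$ congruent to $a_0+pa_1+\cdots+p^{l-1}a_{l-1}$ modulo $p^l$; its length is $l$. Such a set $\mathbf{a}$ is a representative-root of $f \bmod p^k$ if every $\alpha\in\mathbf{a}$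 is a root of $f(x)\bmod p^k$, but not all $\beta\in a_0+pa_1+\cdots+p^{l-2}a_{l-2}+p^{l-1}*$ are roots of $f(x)\bmod p^k$. For $i\in[n]$ and $k>d(\Delta+1)$, the neighborhood of $\alpha_i$ mod $p^k$ is $S_{k,i}:=\{\bar{\alpha}\in\mathbb{Z}/\langle p^k\rangle \mid v_p(\bar{\alpha}-\alpha_i)>\Delta+1,\ f(\bar{\alpha})\equiv 0\bmod p^k\}$, where $v_p(\bar\alpha-\alpha_i)$ is evaluated on any lift of $\bar\alpha$ to $\mathbb{Z}_p$.
   Formalization: The irreducible factors g_j are taken to be nonconstant, so f is not divisible by p; if the constant p is allowed as a factor the claim fails, e.g. f = px, k = 2, Δ = 0, where the representative-root 0 + p* has length 1, not > Δ+1. *)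

(* Defs.v *)
From HB Require Import structures.
From mathcomp Require Import all_boot all_order all_algebra.
From mathcomp Require Import boolp classical_sets constructive_ereal.
Set Implicit Arguments.
Unset Strict Implicit.
Unset Printing Implicit Defensive.
Import Order.TTheory GRing.Theory Num.Theory.
Local Open Scope ring_scope.

(* The ring Z_p as the inverse limit of the rings Z/p^n: the n-th component is
   the representative in [0, p^n) of the residue modulo p^n. The proof of
   primality is a parameter of the type, so that Z_p can be given its integral
   domain structure canonically. *)
Record padic_int (p : nat) (p_pr : prime p) : Type := PadicInt {
  residue : nat -> nat;
  residue_coh : forall n, residue n = (residue n.+1 %% p ^ n)%N }.

HB.instance Definition _ p (p_pr : prime p) := gen_eqMixin (padic_int p_pr).
HB.instance Definition _ p (p_pr : prime p) := gen_choiceMixin (padic_int p_pr).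

Section PadicRing.
Variables (p : nat) (p_pr : prime p).
Local Notation Zp := (padic_int p_pr).

Lemma expp_gt0 n : (0 < p ^ n)%N.
Proof. by rewrite expn_gt0 prime_gt0. Qed.

Lemma padic_eqP (x y : Zp) : residue x =1 residue y -> x = y.
Proof.
case: x y => [u hu] [v hv] /= uv; have {}uv : u = v by apply/funext.
by case: _ / uv hv => hv; congr PadicInt; apply: Prop_irrelevance.
Qed.

Lemma residue_mod (x : Zp) m n : (m <= n)%N ->
  (residue x n %% p ^ m)%N = residue x m.
Proof.
elim: n => [|n IHn].
  by rewrite leqn0 => /eqP ->; rewrite [RHS]residue_coh !modn1.
rewrite leq_eqVlt => /predU1P[-> | lt_mn].
  by rewrite (residue_coh x n.+1) modn_mod.
by rewrite -(IHn lt_mn) (residue_coh x n) modn_dvdm // dvdn_exp2l.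
Qed.

Lemma residue_lt (x : Zp) n : (residue x n < p ^ n)%N.
Proof. by rewrite residue_coh ltn_mod expp_gt0. Qed.

Lemma padic_mk_subproof (s : nat -> nat) :
  (forall n, s n.+1 = s n %[mod p ^ n]) ->
  forall n, (s n %% p ^ n = (s n.+1 %% p ^ n.+1) %% p ^ n)%N.
Proof. by move=> hs n; rewrite modn_dvdm ?dvdn_exp2l // hs. Qed.

Definition padic_mk s (hs : forall n, s n.+1 = s n %[mod p ^ n]) : Zp :=
  PadicInt p_pr (padic_mk_subproof hs).

Lemma padic_const_subproof c : forall n : nat, c = c %[mod p ^ n].
Proof. by []. Qed.

Lemma padic_add_subproof (x y : Zp) n :
  (residue x n.+1 + residue y n.+1 = residue x n + residue y n %[mod p ^ n])%N.
Proof. by rewrite (residue_coh x n) (residue_coh y n) modnDm. Qed.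

Lemma padic_mul_subproof (x y : Zp) n :
  (residue x n.+1 * residue y n.+1 = residue x n * residue y n %[mod p ^ n])%N.
Proof. by rewrite (residue_coh x n) (residue_coh y n) modnMm. Qed.

Lemma padic_opp_subproof (x : Zp) n :
  (p ^ n.+1 - residue x n.+1 = p ^ n - residue x n %[mod p ^ n])%N.
Proof.
apply/eqP; rewrite -(eqn_modDr (residue x n.+1)) subnK ?(ltnW (residue_lt _ _)) //.
rewrite -[in X in _ == X]modnDmr -residue_coh subnK ?(ltnW (residue_lt _ _)) //.
by rewrite modnn expnS modnMl.
Qed.

Definition padic_zero : Zp := padic_mk (padic_const_subproof 0).
Definition padic_one : Zp := padic_mk (padic_const_subproof 1).
Definition padic_add (x y : Zp) : Zp := padic_mk (padic_add_subproof x y).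
Definition padic_mul (x y : Zp) : Zp := padic_mk (padic_mul_subproof x y).
Definition padic_opp (x : Zp) : Zp := padic_mk (padic_opp_subproof x).

Fact padic_addA : associative padic_add.
Proof. by move=> x y z; apply: padic_eqP => n /=; rewrite modnDmr modnDml addnA. Qed.

Fact padic_addC : commutative padic_add.
Proof. by move=> x y; apply: padic_eqP => n /=; rewrite addnC. Qed.

Fact padic_add0 : left_id padic_zero padic_add.
Proof.
by move=> x; apply: padic_eqP => n /=; rewrite mod0n add0n residue_mod.
Qed.

Fact padic_addN : left_inverse padic_zero padic_opp padic_add.
Proof.
move=> x; apply: padic_eqP => n /=.
by rewrite modnDml subnK ?(ltnW (residue_lt _ _)) // modnn mod0n.
Qed.

HB.instance Definition _ := GRing.isZmodule.Build (padic_int p_pr)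
  padic_addA padic_addC padic_add0 padic_addN.

Fact padic_mulA : associative padic_mul.
Proof. by move=> x y z; apply: padic_eqP => n /=; rewrite modnMmr modnMml mulnA. Qed.

Fact padic_mulC : commutative padic_mul.
Proof. by move=> x y; apply: padic_eqP => n /=; rewrite mulnC. Qed.

Fact padic_mul1 : left_id padic_one padic_mul.
Proof.
by move=> x; apply: padic_eqP => n /=; rewrite modnMml mul1n residue_mod.
Qed.

Fact padic_mulDl : left_distributive padic_mul +%R.
Proof.
move=> x y z; apply: padic_eqP => n /=.
by rewrite modnMml modnDml modnDmr mulnDl.
Qed.

Fact padic_one_neq0 : padic_one != 0.
Proof.
apply/eqP => /(congr1 (fun x : Zp => residue x 1)) /=.
by rewrite expn1 mod0n modn_small // prime_gt1.
Qed.

HB.instance Definition _ := GRing.Zmodule_isComNzRing.Build (padic_int p_pr)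
  padic_mulA padic_mulC padic_mul1 padic_mulDl padic_one_neq0.

Definition padic_unit (x : Zp) : bool := `[< exists y : Zp, y * x = 1 >].
Definition padic_inv (x : Zp) : Zp :=
  xget x [set y : Zp | y * x = 1]%classic.

Fact padic_mulVx : {in padic_unit, left_inverse 1 padic_inv *%R}.
Proof. by move=> x /asboolP ux; apply: (xgetPex x ux). Qed.

Fact padic_unitPl (x y : Zp) : y * x = 1 -> padic_unit x.
Proof. by move=> yx; apply/asboolP; exists y. Qed.

Fact padic_inv_out : {in [predC padic_unit], padic_inv =1 id}.
Proof.
move=> x /asboolP nux; rewrite /padic_inv; case: xgetP => // y _ yx.
by case: nux; exists y.
Qed.

HB.instance Definition _ := GRing.ComNzRing_hasMulInverse.Build (padic_int p_pr)
  padic_mulVx padic_unitPl padic_inv_out.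

Lemma padic_neq0 (x : Zp) : x != 0 -> exists n, residue x n.+1 != 0%N.
Proof.
move=> x0; apply: contrapT => nx; case/eqP: x0; apply: padic_eqP => n.
rewrite /= mod0n -(residue_mod x (leqnSn n)).
have -> : residue x n.+1 = 0%N; last by rewrite mod0n.
by apply: contrapT => xn; apply: nx; exists n; apply/eqP.
Qed.

Fact padic_integral : GRing.integral_domain_axiom (padic_int p_pr).
Proof.
move=> x y xy; apply: contraT.
rewrite negb_or => /andP[/padic_neq0[a xa] /padic_neq0[b yb]].
set N := (a.+1 + b.+1)%N.
have {xa} : ~~ (p ^ a.+1 %| residue x N)%N.
  by rewrite /dvdn residue_mod // leq_addr.
have {yb} : ~~ (p ^ b.+1 %| residue y N)%N.
  by rewrite /dvdn residue_mod // leq_addl.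
have : (p ^ N %| residue x N * residue y N)%N.
  rewrite /dvdn; have := congr1 (fun z : Zp => residue z N) xy.
  by rewrite /= mod0n => ->.
case: (posnP (residue x N)) => [->|x0]; first by rewrite dvdn0.
case: (posnP (residue y N)) => [->|y0]; first by rewrite dvdn0.
rewrite !pfactor_dvdn ?muln_gt0 ?x0 // lognM // -!ltnNge /N.
by rewrite !ltnS => h1 h2 h3; have := leq_trans h1 (leq_add h3 h2);
   rewrite addSn addnS ltnNge leqnSn.
Qed.

HB.instance Definition _ :=
  GRing.ComUnitRing_isIntegral.Build (padic_int p_pr) padic_integral.

End PadicRing.

Notation padic_rat p_pr := {fraction (padic_int p_pr)}.

(* Number of leading zero digits; +oo exactly at 0. *)
Definition padic_val (p : nat) (p_pr : prime p) (x : padic_int p_pr) : \bar int :=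
  if pselect (exists n, residue x n.+1 != 0%N) is left ex
  then (ex_minn ex)%:Z%:E else +oo%E.

Definition padic_rat_val (p : nat) (p_pr : prime p) (z : padic_rat p_pr) :
    \bar int :=
  (padic_val \n_(repr z) - padic_val \d_(repr z))%E.

(* L is an algebraically closed extension of F, in which the roots of h, with
   multiplicity, are taken. The right-hand side below is symmetric in the roots,
   so it comes from a unique D in F; [xget] picks it, and its default value 0 is
   never used. The exponent 2 * m - 1, with m the degree, is intended (2 * m - 2
   is another common normalization). *)
Definition discriminant (F : fieldType) (L : closedFieldType)
    (iota : {rmorphism F -> L}) (h : {poly F}) : F :=
  if size h == 2%N then 1 else
  let m := (size h).-1 in
  let r := sval (closed_field_poly_normal (map_poly iota h)) in
  xget 0 [set D : F | iota D = iota (lead_coef h) ^+ (2 * m - 1)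
     * \prod_(i < m) \prod_(j < m | (i < j)%N) (r`_i - r`_j) ^+ 2]%classic.

(* Irreducible element of positive degree of the ring R[x]; in particular the
   constant p is not allowed over Z_p, so that a polynomial having a
   factorization below is primitive over Z_p. This differs from
   [irreducible_poly], which over a domain is irreducibility over its fraction
   field. *)
Definition irreducible_over (R : idomainType) (g : {poly R}) : Prop :=
  (1 < size g)%N /\
  forall q r : {poly R}, g = q * r -> q \is a GRing.unit \/ r \is a GRing.unit.

Definition radical (R : idomainType) (n m : nat)
    (alpha : 'I_n -> R) (g : 'I_m -> {poly R}) : {poly R} :=
  (\prod_i ('X - (alpha i)%:P)) * \prod_j g j.

(* Coprimality of the linear factors with the g j is automatic, as the latter
   have no root; hence the alpha i are exactly the roots of f, with
   multiplicities e i. *)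
Definition is_factorization (R : idomainType) (f : {poly R}) (n m : nat)
    (alpha : 'I_n -> R) (e : 'I_n -> nat)
    (g : 'I_m -> {poly R}) (t : 'I_m -> nat) : Prop :=
  [/\ injective alpha /\ (forall i, 0 < e i)%N,
      forall j, [/\ irreducible_over (g j), forall x, ~~ root (g j) x
                  & (0 < t j)%N],
      forall j j', j != j' -> coprimep (g j) (g j')
    & exists2 u : R, u \is a GRing.unit
        & f = u *: ((\prod_i ('X - (alpha i)%:P) ^+ e i)
                    * \prod_j g j ^+ t j)].

(* Z/p^k is 'Z_(p ^ k), which is the intended ring when k > 0. *)
Definition root_mod (p k : nat) (f : {poly int}) (x : 'Z_(p ^ k)) : bool :=
  root (map_poly intr f) x.

(* a_0 + p a_1 + ... + p^(l-1) a_(l-1) + p^l *, with l the size of a; it is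
   meaningful for l <= k. *)
Definition representative (p k : nat) (a : seq 'I_p) : {set 'Z_(p ^ k)} :=
  [set x : 'Z_(p ^ k) |
     (x : nat) == (\sum_(i < size a) p ^ i * nth 0 (map val a) i)%N
       %[mod p ^ size a]].

Definition is_representative_root (p k : nat) (f : {poly int}) (a : seq 'I_p) :
    Prop :=
  [/\ (0 < size a <= k)%N,
      forall x, x \in representative k a -> root_mod f x
    & ~ (forall y, y \in representative k (take (size a).-1 a) -> root_mod f y)].

Definition reduction (p : nat) (p_pr : prime p) (k : nat) (x : padic_int p_pr) :
    'Z_(p ^ k) := (residue x k)%:R.

(* The valuation is evaluated on the lift of x in [0, p^k). *)
Definition neighborhood (p : nat) (p_pr : prime p) (k : nat) (f : {poly int})
    (Delta : \bar int) (alpha : padic_int p_pr) : {set 'Z_(p ^ k)} :=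
  [set x : 'Z_(p ^ k) |
     (Delta + 1%:E < padic_val ((x : nat)%:R - alpha)%R)%E && root_mod f x].

(* Main.v *)
Require Import Defs.
From HB Require Import structures.
From mathcomp Require Import all_boot all_order all_algebra.
From mathcomp Require Import perm cyclic ring.
From mathcomp Require Import boolp classical_sets constructive_ereal.
Set Implicit Arguments.
Unset Strict Implicit.
Unset Printing Implicit Defensive.
Import Order.TTheory GRing.Theory Num.Theory.
Local Open Scope ring_scope.

(** Write [h] for the radical of [f], [F] for its factors (the [x - alpha_i] and
    the [g_j]), and [pdvd N x] for [p ^ N] divides [x]. All the information
    carried by [Delta] is one statement: at no point of [Z_p] are [h] and [h']
    both divisible by [p ^ (Delta + 1)] ([discriminant_bound]). Indeed
    [D(h)] is, up to sign, the resultant of [h] and [h'], and a resultant is a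
    combination of the two polynomials with integral coefficients. The product
    formula behind the identification ([resultant_roots]) is proved by cancelling
    a Vandermonde determinant, so for distinct roots. This loses nothing: if
    [D(h)] is zero then [Delta] is infinite, and no [k] exceeds
    [d * (Delta + 1)].

    If [p ^ (Delta + 1)] divides [F x] for some factor [F] then, writing
    [h = F * q] and [h' = F' * q + F * q'], it divides neither [F' x] nor
    [q x]. Hence at a given point at most one factor has valuation above [Delta]
    ([other_factor_bound]), and that factor has a derivative of valuation at
    most [Delta] there. By Hensel's lemma a factor without root therefore
    satisfies [v (F x) <= deg F * (Delta + 1)] everywhere
    ([rootless_factor_bound]).

    Since [k > d * (Delta + 1)], a root [x] of [f] modulo [p ^ k] makes some
    factor exceed [deg F * (Delta + 1)], and that factor must be linear: [x] is
    closer than [p ^ (Delta + 1)] to some [alpha_i] ([root_near]). The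
    three claims follow.

    - In a ball of radius [p ^ l] consisting of roots modulo [p ^ k], with
      [l <= Delta + 1], the points [A] and [A + p ^ (Delta + 1)] would both
      be this close to roots, either to the same root, although their difference
      has valuation exactly [Delta + 1], or to two different roots, which are at
      valuation at most [Delta] from each other ([ball_radius]).
    - Two roots in the same ball would be congruent modulo [p ^ (Delta + 1)].
    - Near [alpha_i] all factors other than [x - alpha_i] have constant
      valuation, so the valuation of [f] increases with that of [x - alpha_i]
      ([pdvd_near_root]). A root [x] modulo [p ^ k] near [alpha_i] but outside
      the representative would force the whole ball of length [l - 1] around
      [alpha_i] to consist of roots, against the minimality of [l]. *)

(** * Divisibility by powers of p in the p-adic integers *)

Section PadicDivisibility.
Variables (p : nat) (p_pr : prime p).
Local Notation Zp := (padic_int p_pr).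
Implicit Types (x y z : Zp) (N : nat).

(** Valuations enter the argument only through the predicates [N <= v x], which
    are total and avoid extended integers. *)
Definition pdvd N x : bool := residue x N == 0%N.

Lemma residueD x y N :
  residue (x + y) N = ((residue x N + residue y N) %% p ^ N)%N.
Proof. by []. Qed.

Lemma residueM x y N :
  residue (x * y) N = ((residue x N * residue y N) %% p ^ N)%N.
Proof. by []. Qed.

Lemma residue_nat c N : residue (c%:R : Zp) N = (c %% p ^ N)%N.
Proof.
elim: c => [|c IHc] //.
by rewrite -addn1 natrD residueD IHc [residue 1 N]/= modnDm.
Qed.

Lemma pdvd_nat N c : pdvd N (c%:R : Zp) = (p ^ N %| c)%N.
Proof. by rewrite /pdvd residue_nat. Qed.

Lemma pdvd0 N : pdvd N (0 : Zp).
Proof. by rewrite /pdvd /= mod0n. Qed.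

Lemma pdvdx0 x : pdvd 0 x.
Proof. by rewrite /pdvd residue_coh modn1. Qed.

Lemma pdvdW M N x : (M <= N)%N -> pdvd N x -> pdvd M x.
Proof.
by move=> leMN /eqP xN; rewrite /pdvd -(residue_mod x leMN) xN mod0n.
Qed.

Lemma pdvdD N x y : pdvd N x -> pdvd N y -> pdvd N (x + y).
Proof. by rewrite /pdvd residueD => /eqP-> /eqP->; rewrite mod0n. Qed.

Lemma pdvd_mull N x y : pdvd N y -> pdvd N (x * y).
Proof. by rewrite /pdvd residueM => /eqP->; rewrite muln0 mod0n. Qed.

Lemma pdvd_mulr N x y : pdvd N x -> pdvd N (x * y).
Proof. by rewrite mulrC; apply: pdvd_mull. Qed.

Lemma pdvdN N x : pdvd N (- x) = pdvd N x.
Proof.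
have opp y : pdvd N y -> pdvd N (- y) by rewrite -mulN1r; apply: pdvd_mull.
by apply/idP/idP => /opp; rewrite ?opprK.
Qed.

Lemma pdvdB N x y : pdvd N x -> pdvd N y -> pdvd N (x - y).
Proof. by move=> Nx Ny; rewrite pdvdD ?pdvdN. Qed.

Lemma pdvdBC N x y : pdvd N (x - y) = pdvd N (y - x).
Proof. by rewrite -pdvdN opprB. Qed.

Lemma eq_residue N x y : (residue x N == residue y N) = pdvd N (x - y).
Proof.
apply/eqP/idP => [exy|/eqP dxy].
  have: residue (x - y) N = residue (y - y) N by rewrite !residueD exy.
  by rewrite subrr /pdvd => ->; apply: pdvd0.
by rewrite -(subrK y x) residueD dxy add0n modn_small ?residue_lt.
Qed.

Lemma pdvd_residue N M x : pdvd N x = (p ^ N %| residue x (N + M))%N.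
Proof. by rewrite /pdvd /dvdn residue_mod // leq_addr. Qed.

Lemma pdvdM M N x y : pdvd M x -> pdvd N y -> pdvd (M + N) (x * y).
Proof.
rewrite (pdvd_residue M N x) (pdvd_residue N M y) [(N + M)%N]addnC => dx dy.
by rewrite /pdvd residueM -/(dvdn _ _) [in X in (X %| _)%N]expnD dvdn_mul.
Qed.

(** The inequality [v (x * y) <= v x + v y], which is where [p] has to be prime:
    it is read off residues modulo a power of [p] large enough to determine both
    valuations, through additivity of [logn]. *)
Lemma pdvdMN M N x y : ~~ pdvd M.+1 x -> ~~ pdvd N.+1 y ->
  ~~ pdvd (M + N).+1 (x * y).
Proof.
set K := (M.+1 + N.+1)%N.
rewrite (pdvd_residue M.+1 N.+1 x) (pdvd_residue N.+1 M.+1 y).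
rewrite [(N.+1 + _)%N]addnC -/K => dx dy.
have eK : ((M + N).+1 + 1)%N = K by rewrite /K addn1 addSn addnS.
rewrite (pdvd_residue (M + N).+1 1 _) eK.
rewrite residueM /dvdn modn_dvdm ?dvdn_exp2l //; last first.
  by rewrite -eK leq_addr.
rewrite -/(dvdn _ _).
case: (posnP (residue x K)) dx => [->|x0]; first by rewrite dvdn0.
case: (posnP (residue y K)) dy => [->|y0]; first by rewrite dvdn0.
rewrite !pfactor_dvdn ?muln_gt0 ?x0 // lognM // -!ltnNge !ltnS.
by move=> ? ?; rewrite leq_add.
Qed.

Lemma pdvd_unit x : x \is a GRing.unit -> ~~ pdvd 1 x.
Proof.
move=> ux; apply/negP => /(pdvd_mull x^-1).
by rewrite mulVr // -[1]/(1%:R) pdvd_nat dvdn1 expn1 gtn_eqF ?prime_gt1.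
Qed.

(** The residues of the inverse are powers of those of [x], by Euler's theorem;
    they are coherent because inverses modulo [p ^ N] are unique. *)
Lemma pdvd1_unit x : ~~ pdvd 1 x -> x \is a GRing.unit.
Proof.
move=> x1; pose r N := (residue x N ^ (totient (p ^ N)).-1)%N.
have rV N : (r N * residue x N = 1 %[mod p ^ N])%N.
  case: N => [|N]; first by rewrite !modn1.
  rewrite mulnC /r -expnS prednK ?totient_gt0 ?expp_gt0 //.
  apply: Euler_exp_totient; rewrite coprime_pexpr //.
  rewrite coprime_sym prime_coprime //.
  by move: x1; rewrite (pdvd_residue 1 N) add1n.
have r_coh N : (r N.+1 = r N %[mod p ^ N])%N.
  have rSV : (r N.+1 * residue x N = 1 %[mod p ^ N])%N.
    rewrite (residue_coh x N) modnMmr.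
    have /(congr1 (modn^~ (p ^ N)%N)) := rV N.+1.
    by rewrite !modn_dvdm ?dvdn_exp2l.
  rewrite -[r N.+1]muln1 -modnMmr -rV modnMmr mulnCA -modnMmr rSV modnMmr.
  by rewrite muln1.
apply/unitrP; exists (padic_mk p_pr r_coh); suff: padic_mk p_pr r_coh * x = 1.
  by rewrite mulrC.
by apply: padic_eqP => N; rewrite residueM /= modnMml rV.
Qed.

Lemma pdvd_expP N x : pdvd N x -> exists y, x = p%:R ^+ N * y.
Proof.
move=> Nx; pose s M := (residue x (N + M) %/ p ^ N)%N.
have s_coh M : (s M.+1 = s M %[mod p ^ M])%N.
  by rewrite /s !modn_divl -!expnD [(M + N)%N]addnC !residue_mod // addnS.
exists (padic_mk p_pr s_coh); apply: padic_eqP => M.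
rewrite -natrX residueM residue_nat /= modnMml modnMmr mulnC /s divnK.
  by rewrite residue_mod ?leq_addl.
by rewrite -pdvd_residue.
Qed.

(** [Z_p] is a valuation ring: [x] divides [y] as soon as [v x <= N <= v y]. *)
Lemma pdvd_dvd N x y : ~~ pdvd N.+1 x -> pdvd N y -> exists z, y = z * x.
Proof.
elim: N x y => [|N IHN] x y Nx Ny.
  by exists (y / x); rewrite divrK ?pdvd1_unit.
have [/pdvd_expP[x' ex]|x1] := boolP (pdvd 1 x); last first.
  by exists (y / x); rewrite divrK ?pdvd1_unit.
have [y' ey] := pdvd_expP Ny.
have p1 : pdvd 1 (p%:R : Zp) by rewrite pdvd_nat.
have [||z ez] := IHN x' (p%:R ^+ N * y').
- apply: contra Nx => Nx' /=; rewrite ex expr1 -[N.+2]add1n.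
  exact: pdvdM.
- by apply: pdvd_mulr; rewrite -natrX pdvd_nat.
- by exists z; rewrite ey ex exprS -mulrA ez expr1 mulrCA.
Qed.

Lemma natr_padic_eq0 c : (c%:R == 0 :> Zp) = (c == 0%N).
Proof.
apply/eqP/eqP => [c0|->//]; apply/eqP; rewrite -leqn0 leqNgt; apply/negP => c1.
have : pdvd c (c%:R : Zp) by rewrite c0 pdvd0.
by rewrite pdvd_nat => /(dvdn_leq c1); rewrite leqNgt ltn_expl // prime_gt1.
Qed.

End PadicDivisibility.

(** * Hensel's lemma *)

Lemma horner_sub (R : comNzRingType) (g : {poly R}) (x : R) :
  exists q : {poly R}, forall y, g.[y] = g.[x] + q.[y] * (y - x).
Proof.
have /factor_theorem[q gq] : root (g - g.[x]%:P) x.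
  by rewrite /root !hornerE subrr.
exists q => y; rewrite -[g in LHS](subrK g.[x]%:P) gq !hornerE addrC //.
Qed.

Lemma horner_taylor2 (R : comNzRingType) (g : {poly R}) (x : R) :
  exists r : {poly R}, forall y,
    g.[y] = g.[x] + g^`().[x] * (y - x) + r.[y] * (y - x) ^+ 2.
Proof.
have /factor_theorem[q gq] : root (g - g.[x]%:P) x.
  by rewrite /root !hornerE subrr.
have [r qr] := horner_sub q x.
have g'x : g^`().[x] = q.[x].
  have := congr1 (fun h => h^`().[x]) gq.
  by rewrite derivB derivC subr0 derivM derivXsubC !hornerE subrr mulr0 add0r.
exists r => y; rewrite g'x.
have -> : g.[y] = g.[x] + q.[y] * (y - x).
  by rewrite -[g in LHS](subrK g.[x]%:P) gq !hornerE addrC.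
by rewrite qr; ring.
Qed.

Section Hensel.
Variables (p : nat) (p_pr : prime p).
Local Notation Zp := (padic_int p_pr).
Implicit Types (x y z : Zp) (N : nat) (g : {poly Zp}).

Lemma pdvd_horner g N x y : pdvd N (y - x) -> pdvd N (g.[y] - g.[x]).
Proof.
move=> Nxy; have [q ->] := horner_sub g x.
by rewrite addrC addKr pdvd_mull.
Qed.

Lemma eq_pdvd_horner g N x y :
  pdvd N (y - x) -> pdvd N g.[y] = pdvd N g.[x].
Proof.
move=> /(pdvd_horner g) Ng; apply/idP/idP => [Ny|Nx].
  by rewrite -[g.[x]](subKr g.[y]) pdvdB.
by rewrite -[g.[y]](subrK g.[x]) pdvdD.
Qed.

Lemma padic_complete (u : nat -> Zp) : (forall N, pdvd N (u N.+1 - u N)) ->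
  exists x, forall N, pdvd N (x - u N).
Proof.
move=> u_cauchy.
have u_coh N : (residue (u N.+1) N.+1 = residue (u N) N %[mod p ^ N])%N.
  rewrite residue_mod // modn_small ?residue_lt //.
  by apply/eqP; rewrite eq_residue.
exists (padic_mk p_pr u_coh) => N.
by rewrite -eq_residue /= modn_small ?residue_lt.
Qed.

Lemma pdvd_all_eq0 x : (forall N, pdvd N x) -> x = 0.
Proof.
by move=> dx; apply: padic_eqP => N; rewrite (eqP (dx N)) (eqP (pdvd0 _ N)).
Qed.

(** Newton's correction [w = g x / g' x] is integral and divisible by [p ^ N],
    so the quadratic Taylor remainder is divisible by [p ^ (2 * N)]; as [c < N],
    this is a gain, and [g'] keeps its valuation. *)
Lemma newton_step g c N x : (c < N)%N ->
    ~~ pdvd c.+1 g^`().[x] -> pdvd (N + c) g.[x] ->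
  exists y, [/\ pdvd N (y - x), ~~ pdvd c.+1 g^`().[y] & pdvd (N.+1 + c) g.[y]].
Proof.
move=> lt_cN g'x gx.
have [w gw] : exists w, g.[x] = w * g^`().[x].
  by apply: pdvd_dvd g'x (pdvdW _ gx); rewrite leq_addl.
have Nw : pdvd N w.
  apply: contraLR gx => Nw; rewrite gw.
  case: N lt_cN Nw => // N _ Nw; rewrite addSn; exact: pdvdMN.
exists (x - w); have yx : x - w - x = - w by rewrite addrC addKr.
split.
- by rewrite yx pdvdN.
- rewrite (eq_pdvd_horner _ (_ : pdvd c.+1 (x - w - x))) //.
  by rewrite yx pdvdN; apply: pdvdW Nw.
have [r ->] := horner_taylor2 g x.
rewrite yx mulrN mulrC -gw subrr add0r sqrrN pdvd_mull //.
apply: (@pdvdW _ _ _ (N + N)); last by rewrite expr2 pdvdM.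
by rewrite addSnnS leq_add2l.
Qed.

(** The hypotheses say [v (g' x) <= c] and [v (g x) > 2 * c]. *)
Theorem hensel g c x :
  ~~ pdvd c.+1 g^`().[x] -> pdvd (c.+1 + c) g.[x] -> exists y, root g y.
Proof.
move=> g'x gx.
(* The invariant of Newton's iteration; a single correction needs the exponent
   to exceed c, hence the shift by c.+1. *)
pose P N y := ~~ pdvd c.+1 g^`().[y] /\ pdvd (N + c.+1 + c) g.[y].
have step N y : P N y -> {z | pdvd (N + c.+1) (z - y) /\ P N.+1 z}.
  case=> g'y gy; apply: cid.
  have [|z [zy g'z gz]] := newton_step _ g'y gy; first by rewrite leq_addl.
  by exists z; split=> //; split=> //; rewrite !addSn in gz *.
pose v := fix v N : {y | P N y} := if N is N'.+1 then
    let: exist y Py := v N' in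
    let: exist z Pz := step N' y Py in exist _ z Pz.2
  else exist (P 0%N) x (conj g'x gx).
have v_cauchy N : pdvd N (sval (v N.+1) - sval (v N)).
  rewrite /=; case: (v N) => y Py /=; case: (step _ _ _) => z [zy _] /=.
  by apply: pdvdW zy; rewrite leq_addr.
have [y yv] := padic_complete v_cauchy.
exists y; rewrite /root; apply/eqP/pdvd_all_eq0 => N.
rewrite (eq_pdvd_horner g (yv N)).
by case: (v N) => z [_] /=; apply: pdvdW; rewrite -addnA leq_addr.
Qed.

(** Newton's method is exact in degree 1, so [v (g x) >= c] is enough. The
    leading coefficient may be divisible by [p]. *)
Lemma hensel_linear g c x : size g = 2%N ->
  ~~ pdvd c.+1 g^`().[x] -> pdvd c g.[x] -> exists y, root g y.
Proof.
move=> g2 g'x gx; have [w gw] := pdvd_dvd g'x gx.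
exists (x - w); rewrite /root.
have [a [b eg]] : exists a b, g = a *: 'X + b%:P.
  exists g`_1, g`_0; apply/polyP => -[|[|j]];
    rewrite !coefE ?mulr0 ?mulr1 ?add0r ?addr0 //.
  by rewrite nth_default // g2.
move: gw; rewrite eg !derivE !hornerE => gw.
by rewrite mulrBr addrAC gw [w * a]mulrC subrr.
Qed.

End Hensel.

(** * Discriminant and resultant *)

Section ResultantRoots.
Variable R : idomainType.

(** A row of the Sylvester matrix lists the coefficients of ['X^i * h], so its
    product with a column of powers of [x] is the value at [x]. *)
Lemma horner_Sylvester_row (h : {poly R}) N i x : (size h + i <= N)%N ->
  \sum_(k < N) (h`_(k - i) *+ (i <= k)) * x ^+ k = x ^+ i * h.[x].
Proof.
move=> leN; have szXh : (size ('X^i * h)%R <= N)%N.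
  by rewrite (leq_trans (size_polyMleq _ _)) // size_polyXn addSn /= addnC.
have -> : x ^+ i * h.[x] = ('X^i * h).[x] by rewrite !hornerE.
rewrite (horner_coef_wide _ szXh); apply: eq_bigr => k _.
by rewrite coefXnM ltnNge if_neg mulrb.
Qed.

Variables h q : {poly R}.
Local Notation n := (size q).-1.
Local Notation m := (size h).-1.

(** Multiply the Sylvester matrix by [W = [E | V]], where [V] is the Vandermonde
    matrix of the roots of [h] and the columns of [E] are the unit vectors at
    the exponents [m], ..., [m + n - 1]. The rows of [h] vanish on [V], which
    makes the product block triangular: one diagonal block is triangular with
    diagonal [lead_coef h], the other is the square Vandermonde matrix with its
    columns scaled by the values of [q]. The determinant of [W] is, up to sign,
    that of the square Vandermonde matrix, which can be cancelled because the
    roots are distinct. *)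
Lemma resultant_roots (r : 'I_m -> R) :
    h != 0 -> q != 0 -> injective r -> (forall i, root h (r i)) ->
  exists b : bool,
    resultant h q = (-1) ^+ b * lead_coef h ^+ n * \prod_i q.[r i].
Proof.
move=> h0 q0 r_inj rh.
have szh : size h = m.+1 by rewrite prednK // size_poly_gt0.
have szq : size q = n.+1 by rewrite prednK // size_poly_gt0.
pose E : 'M[R]_(n + m, n) :=
  \matrix_(i < n + m, j < n) ((i : nat) == m + j)%N%:R.
pose V := \matrix_(i < n + m, j < m) r j ^+ i.
pose Vm := Vandermonde m (\row_j r j).
pose S := Sylvester_mx h q; pose W := row_mx E V.
have Su (i : 'I_n) (k : 'I_(n + m)) : usubmx S i k = h`_(k - i) *+ (i <= k).
  by rewrite mxE Sylvester_mxE (unsplitK (inl i)).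
have Sd (i : 'I_m) (k : 'I_(n + m)) : dsubmx S i k = q`_(k - i) *+ (i <= k).
  by rewrite mxE Sylvester_mxE (unsplitK (inr i)).
have SV_u : usubmx S *m V = 0.
  apply/matrixP => i j; rewrite !mxE.
  under eq_bigr do rewrite Su !mxE.
  rewrite horner_Sylvester_row; first by rewrite (rootP (rh j)) mulr0.
  by rewrite szh addSnnS addnC leq_add2r.
have SV_d : dsubmx S *m V = Vm *m diag_mx (\row_j q.[r j]).
  apply/matrixP => i j; rewrite mul_mx_diag !mxE.
  under eq_bigr do rewrite Sd !mxE.
  by rewrite horner_Sylvester_row // szq addSnnS leq_add2l.
have SE_u (i j : 'I_n) : (usubmx S *m E) i j = h`_(m + j - i) *+ (i <= m + j).
  rewrite mxE (bigD1 (cast_ord (addnC m n) (rshift m j))) //= big1 => [|k kj].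
    by rewrite Su !mxE eqxx mulr1 addr0.
  rewrite !mxE; case: eqP => [ek|]; last by rewrite mulr0.
  by case/eqP: kj; apply: val_inj.
have detSW : \det (S *m W)
    = lead_coef h ^+ n * (\det Vm * \prod_j q.[r j]).
  rewrite -[S]vsubmxK mul_col_row SV_u SV_d det_lblock; congr (_ * _).
    rewrite det_trig.
      rewrite (eq_bigr (fun=> lead_coef h)) ?prodr_const ?card_ord // => i _.
      by rewrite SE_u addnK leq_addl.
    apply/is_trig_mxP => i j lt_ij; rewrite SE_u nth_default ?mul0rn //.
    rewrite {1}szh -addnBA ?(ltnW lt_ij) // -[X in (X < _)%N]addn0.
    by rewrite ltn_add2l subn_gt0.
  rewrite det_mulmx det_diag; congr (_ * _).
  by apply: eq_bigr => j _; rewrite mxE.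
(* Exchanging the first m rows of W with the last n ones makes it block upper
   triangular, with an identity block. *)
pose swap x := cast_ord (addnC m n)
  (match split x with inl i => rshift m i | inr i => lshift n i end).
have swap_inj : injective swap.
  move=> x y /cast_ord_inj; rewrite -[x]splitK -[y]splitK !unsplitK.
  case: (split x) (split y) => i [] j //= /eqP.
  - by rewrite eq_rshift => /eqP->.
  - by rewrite eq_rlshift.
  - by rewrite eq_lrshift.
  - by rewrite eq_lshift => /eqP->.
have WE : row_perm (perm swap_inj) W
    = block_mx 1%:M (rowsub (swap \o lshift m) V) 0 Vm.
  apply/matrixP => x y; rewrite -[x]splitK -[y]splitK.
  case: (split x) (split y) => i [] j /=; rewrite mxE permE.
  - rewrite block_mxEul row_mxEl !mxE /swap (unsplitK (inl i)) /=.
    by rewrite eqn_add2l.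
  - by rewrite block_mxEur row_mxEr !mxE.
  - rewrite block_mxEdl row_mxEl !mxE /swap (unsplitK (inr i)) /=.
    by rewrite ltn_eqF // ltn_addr.
  - by rewrite block_mxEdr row_mxEr !mxE /swap (unsplitK (inr i)).
have detW : (-1) ^+ (perm swap_inj) * \det W = \det Vm.
  by rewrite -det_perm -det_mulmx -row_permE WE det_ublock det1 mul1r.
have Vm0 : \det Vm != 0.
  rewrite det_Vandermonde; apply/prodf_neq0 => i _; apply/prodf_neq0 => j lt_ij.
  by rewrite !mxE subr_eq0 (inj_eq r_inj) -val_eqE gtn_eqF.
exists (perm swap_inj); apply: (mulIf Vm0).
rewrite -{1}detW mulrCA -det_mulmx detSW.
by rewrite -!mulrA; congr (_ * (_ * _)); rewrite mulrC.
Qed.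

End ResultantRoots.

(** Injectivity preserves degrees, and with them the size of the Sylvester
    matrix. *)
Lemma map_resultant_inj (aR rR : nzRingType) (phi : {rmorphism aR -> rR})
    (p q : {poly aR}) : injective phi ->
  phi (resultant p q) = resultant (map_poly phi p) (map_poly phi q).
Proof.
move=> phi_inj.
have nz c : c != 0 -> phi c != 0 by rewrite -(inj_eq phi_inj) rmorph0.
have nzl (h : {poly aR}) : h != 0 -> phi (lead_coef h) != 0.
  by rewrite -lead_coef_eq0; apply: nz.
have sz (h : {poly aR}) : size (map_poly phi h) = size h.
  have [->|/nzl] := eqVneq h 0; first by rewrite map_poly0 !size_poly0.
  exact: size_map_poly_id0.
rewrite /resultant /Sylvester_mx !sz.
rewrite -det_map_mx /= map_col_mx; congr (\det (col_mx _ _));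
  by apply: map_lin1_mx => v; rewrite map_poly_rV rmorphM /= map_rVpoly.
Qed.

Section Discriminant.

Lemma deriv_prod_root (R : idomainType) m (c : R) (r : 'I_m -> R) i :
  (c *: \prod_j ('X - (r j)%:P))^`().[r i] = c * \prod_(j | j != i) (r i - r j).
Proof.
rewrite derivZ hornerZ (bigD1 i) //= derivM derivXsubC mul1r hornerD hornerM.
rewrite !hornerXsubC subrr mul0r addr0 horner_prod; congr (_ * _).
by apply: eq_bigr => j _; rewrite hornerXsubC.
Qed.

Lemma prod_pairs_sqr (R : comNzRingType) m (r : 'I_m -> R) : exists N,
  \prod_i \prod_(j | j != i) (r i - r j)
  = (-1) ^+ N * \prod_(i < m) \prod_(j < m | (i < j)%N) (r i - r j) ^+ 2.
Proof.
exists (\sum_(i < m) \sum_(j < m | (i < j)%N) 1)%N.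
have -> : \prod_i \prod_(j | j != i) (r i - r j)
    = \prod_(i < m) \prod_(j < m | (i < j)%N) (r i - r j)
      * \prod_(j < m) \prod_(i < m | (i < j)%N) (r j - r i).
  rewrite -big_split; apply: eq_bigr => i _ /=.
  rewrite (bigID (fun j : 'I_m => (i < j)%N)) /=.
  by congr (_ * _); apply: eq_bigl => j; rewrite neq_ltn; case: ltngtP.
rewrite [X in _ * X](exchange_big_dep xpredT) //= -big_split.
rewrite -prodrXr -big_split; apply: eq_bigr => i _ /=.
rewrite -prodrXr -!big_split; apply: eq_bigr => j _ /=; rewrite expr1; ring.
Qed.

(** A nonzero discriminant is not the default value of its definition, so it is
    given by its product formula, which then forces the roots to be distinct.
    The normalization with exponent [2 * m - 1] is the one for which no power of
    the leading coefficient has to be cleared. *)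
Lemma discriminant_resultant (F : fieldType) (L : closedFieldType)
    (iota : {rmorphism F -> L}) (h : {poly F}) :
    size h != 2%N -> h^`() != 0 -> size h^`() = (size h).-1 ->
    discriminant iota h != 0 ->
  exists N, discriminant iota h = (-1) ^+ N * resultant h h^`().
Proof.
move=> sz2 h'0 szh'.
have h0 : h != 0 by apply: contraNneq h'0 => ->; rewrite deriv0.
rewrite /discriminant (negPf sz2).
case: closed_field_poly_normal => rs /= hL.
set m := (size h).-1; case: xgetP => [D _ /= defD D0|]; last by rewrite eqxx.
have lc0 : lead_coef (map_poly iota h) != 0.
  by rewrite lead_coef_eq0 map_poly_eq0.
have szL : (size (map_poly iota h)).-1 = m by rewrite size_map_poly.
have szrs : size rs = m.
  by rewrite -szL hL size_scale // size_prod_XsubC.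
pose r (i : 'I_(size (map_poly iota h)).-1) := rs`_i.
have hLr : map_poly iota h
    = lead_coef (map_poly iota h) *: \prod_j ('X - (r j)%:P).
  rewrite [LHS]hL (big_nth 0) szrs -szL big_mkord; congr (_ *: _).
have iD0 : iota D != 0 by rewrite fmorph_eq0.
have r_inj : injective r.
  move=> i j rij; apply/eqP; move: iD0; apply: contraNT => ij.
  wlog lt_ij : i j rij ij / (i < j)%N => [IH|].
    case: (ltngtP i j) => [lt_ij|lt_ji|/val_inj eq_ij].
    - exact: IH rij ij lt_ij.
    - by apply: IH (esym rij) _ lt_ji; rewrite eq_sym.
    - by rewrite eq_ij eqxx in ij.
  rewrite defD mulf_eq0; apply/orP; right; rewrite -szL.
  rewrite (bigD1 i) //= (bigD1 j) //= -/(r i) -/(r j) rij.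
  by rewrite subrr expr0n !mul0r.
have rh i : root (map_poly iota h) (r i).
  rewrite hLr rootZ //; apply/rootP; rewrite (bigD1 i) //= hornerM hornerXsubC.
  by rewrite subrr mul0r.
have hL0 : map_poly iota h != 0 by rewrite map_poly_eq0.
have hL'0 : (map_poly iota h)^`() != 0 by rewrite deriv_map map_poly_eq0.
have [b eRes] := resultant_roots hL0 hL'0 r_inj rh.
have [M eM] := prod_pairs_sqr r.
exists (M + b)%N; apply: (fmorph_inj iota).
rewrite rmorphM rmorphXn rmorphN1 (map_resultant_inj _ _ (fmorph_inj iota)).
rewrite -deriv_map eRes.
have -> : \prod_i (map_poly iota h)^`().[r i]
   = lead_coef (map_poly iota h) ^+ m * \prod_i \prod_(j | j != i) (r i - r j).
  rewrite -{1}szL -[X in _ ^+ X]card_ord -prodr_const -big_split.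
  by apply: eq_bigr => i _; rewrite [in LHS]hLr deriv_prod_root.
rewrite deriv_map size_map_poly szh' -/m eM defD lead_coef_map.
set c := iota (lead_coef h); rewrite -szL.
have -> : (2 * (size (map_poly iota h)).-1 - 1 = m.-1 + m)%N.
  rewrite szL; case: (posnP m) => [->//|m0].
  by rewrite mul2n -addnn -subn1 addnBAC.
rewrite !exprD; set P := (X in _ * _ * X = _).
rewrite -[m]szL; set m1 := (size _).-1.
rewrite -[X in (-1) ^+ M * X]/P.
have sgnK (x : L) N : (-1) ^+ N * ((-1) ^+ N * x) = x.
  by rewrite mulrA -expr2 sqrr_sign mul1r.
transitivity (c ^+ m1.-1 * c ^+ m1
  * ((-1) ^+ b * ((-1) ^+ b * ((-1) ^+ M * ((-1) ^+ M * P))))).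
  by rewrite !sgnK.
by rewrite !mulrA; ring.
Qed.

End Discriminant.

(** * The valuation of the discriminant *)

Section Valuation.
Variables (p : nat) (p_pr : prime p).
Local Notation Zp := (padic_int p_pr).
Implicit Types (x y z : Zp) (v N : nat).

Lemma padic_val_eq v x : pdvd v x -> ~~ pdvd v.+1 x -> padic_val x = v%:Z%:E.
Proof.
move=> vx vSx; rewrite /padic_val; case: pselect => [ex|]; last first.
  by case; exists v.
case: ex_minnP => w wx w_min; congr (_%:Z%:E); apply/eqP.
rewrite eqn_leq w_min //= leqNgt; apply/negP => lt_wv.
by case/negP: wx; apply: pdvdW lt_wv vx.
Qed.

Lemma padic_val0 : padic_val (0 : Zp) = +oo%E.
Proof.
rewrite /padic_val; case: pselect => // -[v] /negP[].
exact: pdvd0.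
Qed.

Lemma padic_val_ex x : x != 0 -> exists2 v, pdvd v x & ~~ pdvd v.+1 x.
Proof.
move=> /padic_neq0 ex; case: (ex_minnP ex) => v vx v_min; exists v => //.
case: v vx v_min => [|v] _ v_min; first exact: pdvdx0.
by apply/negPn/negP => /v_min; rewrite ltnn.
Qed.

Lemma padic_val_gt N x : (N%:Z%:E < padic_val x)%E = pdvd N.+1 x.
Proof.
have [->|/padic_val_ex[v vx vSx]] := eqVneq x 0.
  by rewrite padic_val0 ltry pdvd0.
rewrite (padic_val_eq vx vSx) lte_fin ltz_nat; apply/idP/idP => [lt_Nv|].
  exact: pdvdW vx.
by rewrite ltnNge; apply: contraTN => le_vN; apply: contra vSx; apply: pdvdW.
Qed.

(** The representative of a fraction is not normalized, so the denominator
    chosen for [x] need not be [1]; its valuation cancels. *)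
Lemma padic_rat_val_tofrac x :
  padic_rat_val (@FracField.tofrac Zp x) = padic_val x.
Proof.
rewrite /padic_rat_val; set z := repr _.
have ez : \n_z = x * \d_z.
  have := FracField.equivf_r (Ratio x 1).
  rewrite numer_Ratio ?oner_neq0 // denom_Ratio ?oner_neq0 // mul1r => /esym.
  by rewrite /z; unlock FracField.tofrac.
have [vd dd dSd] := padic_val_ex (denom_ratioP z).
rewrite ez (padic_val_eq dd dSd); have [->|] := eqVneq x 0.
  by rewrite mul0r padic_val0.
move=> /padic_val_ex[v vx vSx]; rewrite (padic_val_eq vx vSx).
rewrite (padic_val_eq (pdvdM vx dd) (pdvdMN vSx dSd)) PoszD.
by rewrite -EFinB addrK.
Qed.

(** The degree drops by exactly one because [Z_p] has characteristic 0. *)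
Lemma size_deriv_padic (h : {poly Zp}) : size h^`() = (size h).-1.
Proof.
have [->|h0] := eqVneq h 0; first by rewrite deriv0 size_poly0.
have := lt_size_deriv h0; case sz: (size h) => [|[|m]] // lt_sz.
  by move: lt_sz; rewrite ltnS leqn0 => /eqP.
apply/eqP; rewrite eqn_leq -ltnS lt_sz ltnNge.
apply/negP => /(nth_default 0)/eqP.
rewrite coef_deriv -mulr_natr mulf_eq0 natr_padic_eq0 orbF.
by rewrite -[m.+1]/(m.+2.-1) -sz -lead_coefE lead_coef_eq0 (negPf h0).
Qed.

(** [Delta] is the valuation of the resultant of [h] and [h'], which is a
    combination of [h] and [h'] with coefficients in [Z_p[x]]. In degree 1 the
    discriminant is [1] by convention, and the leading coefficient, which is
    [h'], has to be a unit for the bound to hold. *)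
Lemma discriminant_bound (L : closedFieldType)
    (iota : {rmorphism padic_rat p_pr -> L}) (h : {poly Zp})
    (Delta : \bar int) :
    Delta = padic_rat_val
       (discriminant iota (map_poly (@FracField.tofrac _) h)) ->
    Delta != +oo%E -> (1 < size h)%N ->
    (size h = 2%N -> lead_coef h \is a GRing.unit) ->
  exists2 delta : nat, Delta = delta%:Z%:E &
    forall x, pdvd delta.+1 h.[x] -> ~~ pdvd delta.+1 h^`().[x].
Proof.
set hF := map_poly _ h => -> Delta_fin sz_gt1 sz2_unit.
have tofrac_inj : injective (@FracField.tofrac Zp).
  by move=> x y /eqP; rewrite tofrac_eq => /eqP.
have szF : size hF = size h by apply: size_map_inj_poly; rewrite ?tofrac0.
have [sz2|sz_neq2] := eqVneq (size h) 2%N.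
  have lc1 := pdvd_unit (sz2_unit sz2).
  exists 0%N => [|x _]; last first.
    have : size h^`() = 1%N by rewrite size_deriv_padic sz2.
    move=> /eqP/size_poly1P[c c0 dh]; rewrite dh hornerC.
    by move: lc1; rewrite lead_coefE sz2 /= -[h`_1]mulr1n -coef_deriv dh coefC.
  rewrite /discriminant szF sz2 eqxx -tofrac1 padic_rat_val_tofrac.
  by apply: padic_val_eq; [exact: pdvdx0 | apply: pdvd_unit; exact: unitr1].
have sz_gt2 : (2 < size h)%N by rewrite ltn_neqAle eq_sym sz_neq2.
have szF' : size hF^`() = (size hF).-1.
  rewrite szF -size_deriv_padic /hF deriv_map.
  by apply: size_map_inj_poly; rewrite ?tofrac0.
have D0 : discriminant iota hF != 0.
  apply: contraNneq Delta_fin => ->.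
  by rewrite -tofrac0 padic_rat_val_tofrac padic_val0.
have hF'0 : hF^`() != 0.
  by rewrite -size_poly_gt0 szF' szF; case: (size h) sz_gt2 => [|[]].
have [|N eD] := discriminant_resultant _ hF'0 szF' D0; first by rewrite szF.
pose D := (-1) ^+ N * resultant h h^`().
have {}eD : discriminant iota hF = FracField.tofrac D.
  rewrite eD rmorphM rmorphXn rmorphN1 (map_resultant_inj _ _ tofrac_inj).
  by rewrite -deriv_map.
move: D0; rewrite eD tofrac_eq0 => /padic_val_ex[delta dD dSD].
exists delta; first by rewrite padic_rat_val_tofrac (padic_val_eq dD dSD).
move=> x dh; apply: contra dSD => dh'.
have [||[u v] _ /= eR] := @resultant_in_ideal _ h h^`().
- by [].
- by rewrite size_deriv_padic -ltnS prednK // ltnW // ltnW.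
have := congr1 (horner^~ x) eR; rewrite /= hornerC hornerD !hornerM => eRx.
by rewrite pdvd_mull // eRx pdvdD // pdvd_mull.
Qed.

End Valuation.

(** * Products whose values and derivatives are not both very divisible *)

Section Factors.
Variables (p : nat) (p_pr : prime p).
Local Notation Zp := (padic_int p_pr).
Variables (S : finType) (G : S -> {poly Zp}) (mu : S -> nat).
Variable delta : nat.

Definition degree_sum := (\sum_s mu s * (size (G s)).-1)%N.

Lemma size_prod_exp : (forall s, G s != 0) ->
  size (\prod_s G s ^+ mu s) = degree_sum.+1.
Proof.
move=> G0; rewrite /degree_sum.
apply: (big_ind2 (fun N (h : {poly Zp}) => size h = N.+1))
  => [|N h N' h' eN eN'|s _].
- exact: size_poly1.
- by rewrite size_mul ?eN ?eN' -?size_poly_gt0 ?eN ?eN' // addSn addnS.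
- by rewrite mulnC -size_exp prednK // size_poly_gt0 expf_neq0.
Qed.

Lemma pdvdXN M n (x : Zp) : ~~ pdvd M.+1 x -> ~~ pdvd (n * M).+1 (x ^+ n).
Proof.
move=> Mx; elim: n => [|n IHn]; first by rewrite pdvd_unit ?unitr1.
by rewrite exprS mulSn pdvdMN.
Qed.

(** If [v (G s x) <= deg (G s) * c] for all [s], then these bounds add up, with
    multiplicities, to [degree * c] for the product. *)
Lemma pdvd_prod_expN (u : Zp) (c : nat) (x : Zp) : u \is a GRing.unit ->
    (forall s, ~~ pdvd ((size (G s)).-1 * c).+1 (G s).[x]) ->
  ~~ pdvd (degree_sum * c).+1 (u *: \prod_s G s ^+ mu s).[x].
Proof.
move=> uu Gx; rewrite hornerZ -[(degree_sum * c)%N]add0n.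
apply: pdvdMN; first exact: pdvd_unit.
rewrite /degree_sum big_distrl horner_prod /=.
apply: (big_ind2 (fun N z => ~~ pdvd N.+1 z)) => [|M y N z|s _].
- by rewrite pdvd_unit ?unitr1.
- exact: pdvdMN.
- by rewrite horner_exp -mulnA pdvdXN.
Qed.

Hypothesis prod_bound : forall x, pdvd delta.+1 (\prod_s G s).[x] ->
  ~~ pdvd delta.+1 (\prod_s G s)^`().[x].

Lemma deriv_factor_bound s x : pdvd delta.+1 (G s).[x] ->
  ~~ pdvd delta.+1 (G s)^`().[x].
Proof.
move=> Gx; have := @prod_bound x; rewrite (bigD1 s) //= derivM !hornerE.
move=> /(_ (pdvd_mulr _ Gx)); apply: contra => G'x.
by rewrite pdvdD // pdvd_mulr.
Qed.

Lemma other_factor_bound s s' x : s' != s -> pdvd delta.+1 (G s).[x] ->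
  ~~ pdvd delta.+1 (G s').[x].
Proof.
move=> s's Gx; have := @prod_bound x; rewrite (bigD1 s) //= derivM !hornerE.
move=> /(_ (pdvd_mulr _ Gx)); apply: contra => G'x.
apply: pdvdD; last exact: pdvd_mulr.
by rewrite (bigD1 s') //= hornerM pdvd_mull // pdvd_mulr.
Qed.

(** A larger valuation would produce a root by Hensel's lemma, as the derivative
    of [G s] has valuation at most [delta] at such a point. In degree at least 2
    the valuation exceeds [2 * delta + 2], enough for the general form of that
    lemma; in degree 1 it only exceeds [delta + 1], enough for the linear
    one. *)
Lemma rootless_factor_bound s x : (1 < size (G s))%N ->
    (forall y, ~~ root (G s) y) ->
  ~~ pdvd ((size (G s)).-1 * delta.+1).+1 (G s).[x].
Proof.
move=> sz1 nroot; apply/negP => Gx.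
have G'x : ~~ pdvd delta.+1 (G s)^`().[x].
  apply: deriv_factor_bound; apply: pdvdW Gx.
  by apply: leqW; apply: leq_pmull; rewrite -subn1 subn_gt0.
suff [y] : exists y, root (G s) y by apply/negP.
have [sz2|sz_neq2] := eqVneq (size (G s)) 2%N.
  by apply: (hensel_linear sz2 G'x); apply: pdvdW Gx; rewrite sz2 mul1n !leqW.
apply: (hensel G'x); apply: pdvdW Gx.
have sz3 : (2 <= (size (G s)).-1)%N.
  by rewrite -ltnS prednK ?(ltnW sz1) // ltn_neqAle eq_sym sz_neq2.
apply: leqW; apply: leq_trans (leq_mul sz3 (leqnn _)).
by rewrite mul2n -addnn leq_add2l.
Qed.

End Factors.

(** * Neighborhoods of the p-adic roots *)

Section Neighborhoods.
Variables (p : nat) (p_pr : prime p).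
Local Notation Zp := (padic_int p_pr).
Variables (n m : nat) (alpha : 'I_n -> Zp) (e : 'I_n -> nat).
Variables (g : 'I_m -> {poly Zp}) (t : 'I_m -> nat) (F : {poly Zp}).
Hypothesis F_fact : is_factorization F alpha e g t.
Variable delta : nat.
Hypothesis rad_bound : forall x, pdvd delta.+1 (radical alpha g).[x] ->
  ~~ pdvd delta.+1 (radical alpha g)^`().[x].

(** Indexing the linear and the rootless factors by one finite type makes the
    radical and [F] products of the same family. *)
Definition factor (s : 'I_n + 'I_m) : {poly Zp} :=
  match s with inl i => 'X - (alpha i)%:P | inr j => g j end.
Definition multiplicity (s : 'I_n + 'I_m) : nat :=
  match s with inl i => e i | inr j => t j end.

Lemma radicalE : radical alpha g = \prod_s factor s.
Proof. by rewrite big_sumType. Qed.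

Lemma factorizationE : exists2 u, u \is a GRing.unit &
  F = u *: \prod_s factor s ^+ multiplicity s.
Proof.
by case: F_fact => _ _ _ [u uu ->]; exists u; rewrite // big_sumType.
Qed.

Lemma factor_size s : (1 < size (factor s))%N.
Proof.
case: s => [i|j] /=; first by rewrite size_XsubC.
by case: F_fact => _ /(_ j)[[]].
Qed.

Lemma size_factorization : size F = (degree_sum factor multiplicity).+1.
Proof.
have [u uu ->] := factorizationE.
rewrite size_scale; last by apply: contraTneq uu => ->; rewrite unitr0.
by rewrite size_prod_exp // => s; rewrite -size_poly_gt0 ltnW // factor_size.
Qed.

Lemma degree_sum_ge (mu : 'I_n + 'I_m -> nat) : (forall s, 0 < mu s)%N ->
  (n + m <= degree_sum factor mu)%N.
Proof.
move=> mu_gt0; have -> : (n + m)%N = #|{: 'I_n + 'I_m}|.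
  by rewrite card_sum !card_ord.
rewrite -sum1_card; apply: leq_sum => s _.
by rewrite muln_gt0 mu_gt0 -subn1 subn_gt0 factor_size.
Qed.

Lemma size_factorization_gt : (n + m < size F)%N.
Proof.
rewrite size_factorization ltnS degree_sum_ge // => -[i|j] /=.
  by case: F_fact => -[].
by case: F_fact => _ /(_ j)[].
Qed.

Lemma size_radical_gt : (n + m < size (radical alpha g))%N.
Proof.
have -> : radical alpha g = \prod_s factor s ^+ 1.
  by rewrite radicalE; apply: eq_bigr => s _; rewrite expr1.
rewrite (size_prod_exp (fun=> 1%N)) ?ltnS ?degree_sum_ge // => s.
by rewrite -size_poly_gt0 ltnW // factor_size.
Qed.

Let factor_bound x : pdvd delta.+1 (\prod_s factor s).[x] ->
  ~~ pdvd delta.+1 (\prod_s factor s)^`().[x].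
Proof. by rewrite -radicalE; apply: rad_bound. Qed.

(** Otherwise [v (factor s x) <= deg (factor s) * (delta + 1)] for every [s]:
    for the linear factors by assumption, for the others by Hensel's lemma. *)
Lemma root_near k x : ((size F).-1 * delta.+1 < k)%N -> pdvd k F.[x] ->
  exists i, pdvd delta.+2 (x - alpha i).
Proof.
move=> lt_k Fx; apply: contrapT => far.
have /negP[] : ~~ pdvd ((size F).-1 * delta.+1).+1 F.[x]; last exact: pdvdW Fx.
rewrite size_factorization; have [u uu ->] := factorizationE.
apply: pdvd_prod_expN => // -[i|j] /=.
  rewrite size_XsubC mul1n hornerXsubC.
  by apply/negP => xi; apply: far; exists i.
apply: (rootless_factor_bound factor_bound (s := inr j)).
  exact: factor_size.
by case: F_fact => _ /(_ j)[].
Qed.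

(** Two factors cannot be small at the same point; at [x = alpha i] this bounds
    the valuation of [alpha i - alpha j]. *)
Lemma near_root_far i j x : j != i -> pdvd delta.+1 (x - alpha i) ->
  ~~ pdvd delta.+1 (x - alpha j).
Proof.
move=> ji xi; rewrite -hornerXsubC.
apply: (other_factor_bound factor_bound (s := inl i) (s' := inl j)) => //=.
by rewrite hornerXsubC.
Qed.

(** The only factor of [f] whose valuation varies on a small ball around
    [alpha i] is [x - alpha i] itself, and the hypotheses say
    [v (x - alpha i) <= N <= v (y - alpha i)]. Factor by factor, the value at
    [x] therefore divides the value at [y]. *)
Lemma pdvd_near_root i N k x y : (delta < N)%N ->
    pdvd delta.+1 (x - alpha i) -> ~~ pdvd N.+1 (x - alpha i) ->
    pdvd N (y - alpha i) -> pdvd k F.[x] -> pdvd k F.[y].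
Proof.
move=> lt_dN xi xiN yi.
have yi' : pdvd delta.+1 (y - alpha i) by apply: pdvdW yi.
have xy : pdvd delta.+1 (y - x).
  by rewrite -(subrKA (alpha i)) pdvdD // pdvdBC.
suff [z ->] : exists z, F.[y] = z * F.[x] by apply: pdvd_mull.
have [u _ ->] := factorizationE.
suff [z ez] : exists z, (\prod_s factor s ^+ multiplicity s).[y]
    = z * (\prod_s factor s ^+ multiplicity s).[x].
  by exists z; rewrite !hornerZ ez mulrCA.
rewrite !horner_prod; apply: (big_ind2 (fun a b => exists z, a = z * b)).
- by exists 1; rewrite mulr1.
- by move=> _ b _ d [z ->] [w ->]; exists (z * w); rewrite mulrACA.
move=> s _; rewrite !horner_exp.
suff [z ->] : exists z, (factor s).[y] = z * (factor s).[x].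
  by exists (z ^+ multiplicity s); rewrite exprMn.
have [->|si] := eqVneq s (inl i).
  by rewrite /= !hornerXsubC; apply: pdvd_dvd xiN yi.
have sx : ~~ pdvd delta.+1 (factor s).[x].
  by apply: (other_factor_bound factor_bound si); rewrite /= hornerXsubC.
have [z ez] : exists z, (factor s).[y] - (factor s).[x] = z * (factor s).[x].
  exact: pdvd_dvd sx (pdvd_horner _ (pdvdW (leqnSn _) xy)).
by exists (z + 1); rewrite mulrDl -ez mul1r subrK.
Qed.

(** The witnesses are [A] and [B = A + p ^ (delta + 1)]: too far apart to be
    close to the same root, too close to each other to be close to different
    ones. *)
Lemma ball_radius k l A : ((size F).-1 * delta.+1 < k)%N ->
  (forall x, pdvd l (x - A) -> pdvd k F.[x]) -> (delta.+1 < l)%N.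
Proof.
move=> lt_k ball; rewrite ltnNge; apply/negP => le_ld.
have [|i Ai] := root_near lt_k (ball A _); first by rewrite subrr pdvd0.
pose B := A + (p ^ delta.+1)%:R.
have BA : B - A = (p ^ delta.+1)%:R by rewrite addrC addKr.
have [|j Bj] := root_near lt_k (ball B _).
  by rewrite BA pdvd_nat dvdn_exp2l.
have [eji|ji] := eqVneq j i.
  have : pdvd delta.+2 (B - A).
    by rewrite -(subrKA (alpha i)) pdvdD // -?eji // pdvdBC eji.
  by rewrite BA pdvd_nat dvdn_Pexp2l ?ltnn // prime_gt1.
have /negP[] : ~~ pdvd delta.+1 (A - alpha j).
  by apply: near_root_far ji (pdvdW _ Ai).
rewrite -(subrKA B) pdvdD //; last exact: pdvdW Bj.
by rewrite pdvdBC BA pdvd_nat.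
Qed.

End Neighborhoods.

(** * Reduction modulo powers of p *)

Section Reduction.
Variables (p : nat) (p_pr : prime p).
Local Notation Zp := (padic_int p_pr).
Implicit Types (x y z : Zp) (k : nat).

(** Reduction is a ring morphism only for a positive exponent, since ['Z_1] is
    the ring of integers modulo 2; successor exponents let the morphism
    structure be declared once and for all. *)
Definition reductionS k (x : Zp) : 'Z_(p ^ k.+1) := reduction k.+1 x.

Lemma expp_gt1 k : (1 < p ^ k.+1)%N.
Proof. by rewrite -(expn0 p) ltn_exp2l ?prime_gt1. Qed.

Lemma val_reductionS k x : (reductionS k x : nat) = residue x k.+1.
Proof. by rewrite val_Zp_nat ?expp_gt1 // modn_small ?residue_lt. Qed.

Lemma reductionS_zmod k : zmod_morphism (@reductionS k).
Proof.
move=> x y; apply: (addIr (reductionS k y)); rewrite subrK.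
apply: val_inj; rewrite /= !val_reductionS Zp_cast ?expp_gt1 //.
by rewrite -residueD subrK.
Qed.

Lemma reductionS_monoid k : monoid_morphism (@reductionS k).
Proof.
split=> [|x y]; apply: val_inj => /=; rewrite !val_reductionS.
  by rewrite /= Zp_cast ?expp_gt1.
by rewrite Zp_cast ?expp_gt1.
Qed.

HB.instance Definition _ k := GRing.isZmodMorphism.Build Zp 'Z_(p ^ k.+1)
  (@reductionS k) (reductionS_zmod k).
HB.instance Definition _ k := GRing.isMonoidMorphism.Build Zp 'Z_(p ^ k.+1)
  (@reductionS k) (reductionS_monoid k).

Lemma root_mod_reduction k (f : {poly int}) x : (0 < k)%N ->
  root_mod f (reduction k x) = pdvd k (map_poly intr f).[x].
Proof.
case: k => // k _; rewrite -[reduction k.+1 x]/(reductionS k x) /root_mod /root.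
have -> : map_poly intr f = map_poly (@reductionS k) (map_poly intr f).
  by rewrite -map_poly_comp; apply: eq_map_poly => c /=; rewrite rmorph_int.
by rewrite horner_map -val_eqE /= val_reductionS.
Qed.

Lemma reduction_nat k (x : 'Z_(p ^ k)) : (0 < k)%N ->
  reduction k ((x : nat)%:R : Zp) = x.
Proof.
case: k x => // k x _; rewrite /reduction residue_nat modn_small ?natr_Zp //.
by rewrite -[ltnRHS](Zp_cast (expp_gt1 k)).
Qed.

Definition code (a : seq 'I_p) : nat :=
  (\sum_(i < size a) p ^ i * nth 0 (map val a) i)%N.

Lemma in_representative k (a : seq 'I_p) x : (0 < k)%N -> (size a <= k)%N ->
  (reduction k x \in representative k a) = pdvd (size a) (x - (code a)%:R).
Proof.
case: k => // k _ le_ak; rewrite inE -/(code a).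
rewrite -[reduction k.+1 x]/(reductionS k x) val_reductionS residue_mod //.
by rewrite -eq_residue residue_nat.
Qed.

Lemma pdvd_code_take (a : seq 'I_p) :
  pdvd (size a).-1 ((code (take (size a).-1 a))%:R - (code a)%:R : Zp).
Proof.
case/lastP: a => [|a c]; first exact: pdvdx0.
rewrite size_rcons /= -{1}cats1 take_size_cat // pdvdBC.
have -> : code (rcons a c) = (code a + p ^ size a * c)%N.
  rewrite /code size_rcons big_ord_recr /= map_rcons nth_rcons size_map.
  rewrite ltnn eqxx.
  congr (_ + _)%N; apply: eq_bigr => i _.
  by rewrite nth_rcons size_map ltn_ord.
by rewrite natrD addrC addKr pdvd_nat dvdn_mulr.
Qed.

End Reduction.

(** * Representative-roots and neighborhoods *)

Theorem theorem17 (p : nat) (p_pr : prime p)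
    (f : {poly int}) (d : nat) (f_deg : size f = d.+1)
    (n m : nat) (alpha : 'I_n -> padic_int p_pr) (e : 'I_n -> nat)
    (g : 'I_m -> {poly padic_int p_pr}) (t : 'I_m -> nat)
    (f_fact : is_factorization (map_poly intr f) alpha e g t)
    (L : closedFieldType) (iota : {rmorphism padic_rat p_pr -> L})
    (L_alg : forall z : L, algebraicOver iota z)
    (Delta : \bar int)
    (Delta_def : Delta = padic_rat_val
       (discriminant iota (map_poly (@FracField.tofrac _) (radical alpha g))))
    (k : nat) (k_gt : (d%:Z%:E * (Delta + 1%:E) < k%:Z%:E)%E)
    (a : seq 'I_p) (a_rep : is_representative_root k f a)
    (i : 'I_n) :
  [/\ (Delta + 1%:E < (size a)%:Z%:E)%E,
      reduction k (alpha i) \in representative k a ->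
        forall j, j != i -> reduction k (alpha j) \notin representative k a
    & reduction k (alpha i) \in representative k a ->
        neighborhood k f Delta (alpha i) \subset representative k a
        /\ neighborhood k f Delta (alpha i) = representative k a].
Proof.
set F := map_poly intr f in f_fact.
have F_size : (size F <= d.+1)%N by rewrite -f_deg size_poly.
have n_gt0 : (0 < n)%N := leq_ltn_trans (leq0n i) (ltn_ord i).
have rad_size := size_radical_gt f_fact.
have F_size1 : (1 < size F)%N.
  apply: leq_ltn_trans (size_factorization_gt f_fact).
  by rewrite addn_gt0 n_gt0.
have d_gt0 : (0 < d)%N by rewrite -ltnS (leq_trans F_size1).
(* An infinite Delta, hence also a zero discriminant, contradicts k_gt. *)
have Delta_fin : Delta != +oo%E.
  apply/negP => /eqP Delta_oo; move: k_gt.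
  by rewrite Delta_oo addye // gt0_muley.
(* As alpha i is a root, a radical of degree 1 has no factor g j. *)
have rad_monic : size (radical alpha g) = 2%N ->
    lead_coef (radical alpha g) \is a GRing.unit.
  move=> sz2; rewrite sz2 ltnS in rad_size.
  have m0 : m = 0%N by case: (n) (m) n_gt0 rad_size => [|[|?]] [].
  rewrite /radical [X in _ * X]big1 => [|j _]; last first.
    by have := leq_ltn_trans (leq0n j) (ltn_ord j); rewrite m0.
  by rewrite mulr1 (monicP (monic_prod_XsubC _ _ _)) unitr1.
have rad_size1 : (1 < size (radical alpha g))%N.
  by apply: leq_ltn_trans rad_size; rewrite addn_gt0 n_gt0.
have [delta eDelta rad_bound] :=
  discriminant_bound Delta_def Delta_fin rad_size1 rad_monic.
rewrite eDelta -EFinD -EFinM -PoszD -PoszM addn1 lte_fin ltz_nat in k_gt *.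
have {}k_gt : ((size F).-1 * delta.+1 < k)%N.
  apply: leq_ltn_trans k_gt; rewrite leq_mul2r; apply/orP; right.
  by rewrite -ltnS prednK // ltnW.
have [/andP[a_gt0 le_ak] a_roots a_max] := a_rep.
have k_gt0 : (0 < k)%N by apply: leq_trans le_ak.
set l := size a in a_gt0 le_ak *; pose A : padic_int p_pr := (code a)%:R.
have ball x : pdvd l (x - A) -> pdvd k F.[x].
  rewrite -(in_representative _ k_gt0 le_ak) => /a_roots.
  by rewrite root_mod_reduction.
have lt_dl := ball_radius f_fact rad_bound k_gt ball.
split.
- by rewrite lte_fin ltz_nat.
- rewrite in_representative // => ai j ji; rewrite in_representative //.
  have : ~~ pdvd delta.+1 (alpha i - alpha j).
    by apply: (near_root_far rad_bound ji); rewrite subrr pdvd0.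
  apply: contra => aj; apply: (pdvdW (ltnW lt_dl)).
  by rewrite -(subrKA A) pdvdD // (pdvdBC _ A).
rewrite in_representative // => ai.
suff eS : neighborhood k f (delta%:Z%:E) (alpha i) = representative k a.
  by rewrite eS.
apply/setP => x; pose x' : padic_int p_pr := (x : nat)%:R.
have ex : x = reduction k x' by rewrite reduction_nat.
have -> : (x \in representative k a) = pdvd l (x' - A).
  by rewrite ex in_representative.
have -> : (x \in neighborhood k f delta%:Z%:E (alpha i))
    = pdvd delta.+2 (x' - alpha i) && pdvd k F.[x'].
  rewrite inE -/x' -EFinD -PoszD addn1 padic_val_gt; congr (_ && _).
  by rewrite ex root_mod_reduction.
apply/andP/idP => [[x'i Fx']|x'A].
  (* Otherwise the value of f at x' divides its values on the whole ball of
     length l - 1 around alpha i. *)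
  apply: contrapT => /negP x'A; apply: a_max => y.
  rewrite -(reduction_nat p_pr y) //; set y' : padic_int p_pr := _%:R.
  have szt : size (take l.-1 a) = l.-1 by rewrite size_takel // leq_pred.
  rewrite in_representative // szt ?(leq_trans (leq_pred _)) // => y'A.
  rewrite root_mod_reduction //.
  apply: (pdvd_near_root f_fact rad_bound (i := i) (N := l.-1) (x := x')) => //.
  - by rewrite -ltnS prednK.
  - exact: pdvdW x'i.
  - rewrite prednK //; apply: contra x'A => x'i'.
    by rewrite -(subrKA (alpha i)) pdvdD.
  rewrite -(subrKA A) pdvdD //; last first.
    by rewrite pdvdBC; apply: pdvdW (leq_pred _) ai.
  by rewrite -(subrKA (code (take l.-1 a))%:R) pdvdD // pdvd_code_take.
have x'i : pdvd l (x' - alpha i) by rewrite -(subrKA A) pdvdD // pdvdBC.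
split; first exact: pdvdW x'i.
exact: ball.
Qed.
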